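(* Let $K$ be an algebraically closed field of characteristic zero and let $h=(1,3,h_2,h_3,h_4)$ be an O-sequence. (a) Suppose $h_4=1$. Then $h$ is a Gorenstein O-sequence if and only if $h_3\le 3$ and $h_2\le \binom{h_3+1}{2}+(3-h_3)$. (b) Suppose $h_4\ge 2$. Then $h$ is a level O-sequence if and only if $h_3\le 3h_4$.
   Context: $K$ is an algebraically closed field of characteristic zero. An Artinian local $K$-algebra is a ring $A=R/I$ of finite $K$-dimension, where $R=K[[x_1,\dots,x_r]]$ is a formal power series ring and $I$ is a proper ideal of $R$ (Artinian standard graded $K$-algebras are a special case); $\mathfrak m$ denotes its maximal ideal. Its Hilbert function (or $h$-vector) is $h=(h_0,h_1,\dots,h_s)$ with $h_i=\dim_K \mathfrak m^i/\mathfrak m^{i+1}$, where the socle degree $s$ is the largest integer $j$ with $\mathfrak m^j\neq 0$. The socle is $\mathrm{Soc}(A)=(0:\mathfrak m)$ and the type of $A$ is $\tau=\dim_K \mathrm{Soc}(A)$. $A$ is level (of type $\tau$) if $\mathrm{Soc}(A)=\mathfrak m^s$ and $\dim_K\mathfrak m^s=\tau$. $A$ is Gorenstein if it has type $1$. A sequence of positive integers $h=(h_0,h_1,\dots,h_s)$ is an O-sequence if $h_0=1$ and $h_{i+1}\le h_i^{\langle i\rangle}$ for $i=1,\dots,s-1$. Here, if $a=\binom{a_i}{i}+\binom{a_{i-1}}{i-1}+\cdots+\binom{a_j}{j}$ with $a_i>a_{i-1}>\cdots>a_j\ge j\ge 1$ is the $i$-binomial expansion of a positive integer $a$, then $a^{\langle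 i\rangle}=\binom{a_i+1}{i+1}+\binom{a_{i-1}+1}{i}+\cdots+\binom{a_j+1}{j+1}$. A sequence $h=(1,h_1,\dots,h_s)$ is a level (respectively Gorenstein) O-sequence if it is the Hilbert function of some Artinian level (respectively Gorenstein) local $K$-algebra (not required to be graded). *)

(* Defs.v *)
From HB Require Import structures.
From mathcomp Require Import all_boot all_order all_algebra all_field.
From mathcomp Require Import boolp mpoly.

Set Implicit Arguments.
Unset Strict Implicit.
Unset Printing Implicit Defensive.

Import GRing.Theory.
Local Open Scope ring_scope.

(** * Formal power series in [n] variables *)

Record fps (n : nat) (R : nzRingType) :=
  FPS { fpscoef : 'X_{1..n} -> R }.

Notation "{ 'fps' R [ n ] }" := (fps n R)
  (at level 0, R at level 2, n at level 2, format "{ 'fps'  R [ n ] }").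

Section FpsZmodule.
Variables (n : nat) (R : nzRingType).
Implicit Types f g h : {fps R[n]}.

HB.instance Definition _ := gen_eqMixin {fps R[n]}.
HB.instance Definition _ := gen_choiceMixin {fps R[n]}.

Lemma fpsP f g : fpscoef f =1 fpscoef g <-> f = g.
Proof. by split=> [|-> //]; case: f; case: g => g f /= /funext ->. Qed.

Definition fps_zero : {fps R[n]} := FPS (fun=> 0).
Definition fps_opp f : {fps R[n]} := FPS (fun m => - fpscoef f m).
Definition fps_add f g : {fps R[n]} :=
  FPS (fun m => fpscoef f m + fpscoef g m).

Lemma fps_addA : associative fps_add.
Proof. by move=> f g h; apply/fpsP=> m /=; rewrite addrA. Qed.
Lemma fps_addC : commutative fps_add.
Proof. by move=> f g; apply/fpsP=> m /=; rewrite addrC. Qed.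
Lemma fps_add0 : left_id fps_zero fps_add.
Proof. by move=> f; apply/fpsP=> m /=; rewrite add0r. Qed.
Lemma fps_addN : left_inverse fps_zero fps_opp fps_add.
Proof. by move=> f; apply/fpsP=> m /=; rewrite addNr. Qed.

HB.instance Definition _ :=
  GRing.isZmodule.Build {fps R[n]} fps_addA fps_addC fps_add0 fps_addN.

Definition fps_scale (c : R) f : {fps R[n]} :=
  FPS (fun m => c * fpscoef f m).

Lemma fps_scaleA c d f : fps_scale c (fps_scale d f) = fps_scale (c * d) f.
Proof. by apply/fpsP=> m /=; rewrite mulrA. Qed.
Lemma fps_scale1 : left_id 1 fps_scale.
Proof. by move=> f; apply/fpsP=> m /=; rewrite mul1r. Qed.
Lemma fps_scaleDr : right_distributive fps_scale +%R.
Proof. by move=> c f g; apply/fpsP=> m /=; rewrite mulrDr. Qed.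
Lemma fps_scaleDl f : {morph fps_scale^~ f : c d / c + d}.
Proof. by move=> c d; apply/fpsP=> m /=; rewrite mulrDl. Qed.

HB.instance Definition _ := GRing.Zmodule_isLmodule.Build R {fps R[n]}
  fps_scaleA fps_scale1 fps_scaleDr fps_scaleDl.

Definition fps_one : {fps R[n]} := FPS (fun m => (m == 0%MM)%:R).

(* Cauchy product; the bound on the degrees only serves to make the set of
   decompositions [m = k.1 + k.2] a finite type. *)
Definition fps_mul f g : {fps R[n]} :=
  FPS (fun m => \sum_(k : 'X_{1..n < (mdeg m).+1, (mdeg m).+1}
                        | m == (k.1 + k.2)%MM)
                   fpscoef f k.1 * fpscoef g k.2).

Definition fps_trunc (d : nat) f : {mpoly R[n]} :=
  \sum_(m : 'X_{1..n < d}) fpscoef f m *: 'X_[m].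

Lemma fps_truncE d f m : (mdeg m < d)%N -> (fps_trunc d f)@_m = fpscoef f m.
Proof. exact: mcoeff_mpoly. Qed.

Lemma mcoeffM_eq (p p' q q' : {mpoly R[n]}) m :
    (forall k, (mdeg k <= mdeg m)%N -> p@_k = p'@_k) ->
    (forall k, (mdeg k <= mdeg m)%N -> q@_k = q'@_k) ->
  (p * q)@_m = (p' * q')@_m.
Proof.
move=> eqp eqq; rewrite !mcoeffM; apply: eq_bigr => k _.
by rewrite eqp ?eqq // -ltnS bmdeg.
Qed.

Lemma fps_mulE d f g m : (mdeg m < d)%N ->
  fpscoef (fps_mul f g) m = (fps_trunc d f * fps_trunc d g)@_m.
Proof.
move=> ltmd; rewrite mcoeffM /=; apply: eq_bigr => k _.
by rewrite !fps_truncE // (leq_trans (bmdeg _)).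
Qed.

Lemma fps_trunc_mul d f g m : (mdeg m < d)%N ->
  (fps_trunc d (fps_mul f g))@_m = (fps_trunc d f * fps_trunc d g)@_m.
Proof. by move=> ltmd; rewrite fps_truncE // -fps_mulE. Qed.

Lemma fps_trunc_one d m : (mdeg m < d)%N -> (fps_trunc d fps_one)@_m = 1@_m.
Proof. by move=> ltmd; rewrite fps_truncE // mcoeff1. Qed.

Lemma fps_mulA : associative fps_mul.
Proof.
move=> f g h; apply/fpsP=> m; rewrite !(@fps_mulE (mdeg m).+1) //.
transitivity ((fps_trunc (mdeg m).+1 f *
  (fps_trunc (mdeg m).+1 g * fps_trunc (mdeg m).+1 h))@_m).
  by apply: mcoeffM_eq => // k lekm; apply: fps_trunc_mul.
by rewrite mulrA; apply: mcoeffM_eq => // k lekm; rewrite fps_trunc_mul.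
Qed.

Lemma fps_mul1 : left_id fps_one fps_mul.
Proof.
move=> f; apply/fpsP=> m; rewrite (@fps_mulE (mdeg m).+1) //.
rewrite -[RHS](@fps_truncE (mdeg m).+1) // -[in RHS](mul1r (fps_trunc _ f)).
by apply: mcoeffM_eq => // k lekm; apply: fps_trunc_one.
Qed.

Lemma fps_mulr1 : right_id fps_one fps_mul.
Proof.
move=> f; apply/fpsP=> m; rewrite (@fps_mulE (mdeg m).+1) //.
rewrite -[RHS](@fps_truncE (mdeg m).+1) // -[in RHS](mulr1 (fps_trunc _ f)).
by apply: mcoeffM_eq => // k lekm; apply: fps_trunc_one.
Qed.

Lemma fps_mulDl : left_distributive fps_mul +%R.
Proof.
move=> f g h; apply/fpsP=> m /=.
by rewrite -big_split; apply: eq_bigr => k _; rewrite mulrDl.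
Qed.

Lemma fps_mulDr : right_distributive fps_mul +%R.
Proof.
move=> f g h; apply/fpsP=> m /=.
by rewrite -big_split; apply: eq_bigr => k _; rewrite mulrDr.
Qed.

Lemma fps_one_neq0 : fps_one != 0.
Proof.
by apply/eqP=> /fpsP/(_ 0%MM)/eqP; rewrite /= eqxx oner_eq0.
Qed.

HB.instance Definition _ := GRing.Zmodule_isNzRing.Build {fps R[n]}
  fps_mulA fps_mul1 fps_mulr1 fps_mulDl fps_mulDr fps_one_neq0.

Lemma fps_scaleAl (c : R) f g : c *: (f * g) = (c *: f) * g.
Proof.
apply/fpsP=> m /=; rewrite mulr_sumr.
by apply: eq_bigr => k _; rewrite mulrA.
Qed.

HB.instance Definition _ :=
  GRing.Lmodule_isLalgebra.Build R {fps R[n]} fps_scaleAl.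

End FpsZmodule.

Section FpsComRing.
Variables (n : nat) (R : comNzRingType).

Lemma fps_mulC : @commutative {fps R[n]} _ *%R.
Proof.
move=> f g; apply/fpsP=> m.
by rewrite !(@fps_mulE _ _ (mdeg m).+1) // mulrC.
Qed.

HB.instance Definition _ :=
  GRing.PzRing_hasCommutativeMul.Build {fps R[n]} fps_mulC.
HB.instance Definition _ :=
  GRing.Lalgebra_isComAlgebra.Build R {fps R[n]}.

End FpsComRing.

(** * Artinian local algebras *)

Section ArtinianLocal.
Variables (K : fieldType) (A : falgType K).
Implicit Types (J m : {vspace A}) (h : seq nat).

(* [A] is (isomorphic to) [R/I] for [R = K[[x_1,...,x_r]]] and [I] the kernel
   of [phi]; [I] is proper because [1 != 0] in [A], and the dimension is finite
   because [A] is an [falgType]. In particular [A] is commutative and local. *)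
Definition artinian_local : Prop :=
  exists r : nat, exists phi : {lrmorphism {fps K[r]} -> A},
    forall a : A, exists f : {fps K[r]}, phi f = a.

(* Ideals of [A] are [K]-subspaces; one-sided closure suffices, as these
   notions are only used for commutative [A]. *)
Definition is_ideal J : Prop := (J * {:A} <= J)%VS.

Definition is_maximal_ideal m : Prop :=
  [/\ is_ideal m, m != fullv
    & forall J, is_ideal J -> (m <= J)%VS -> J = m \/ J = fullv].

(* [(m ^+ 0)%VS] is the line [K.1] rather than the unit ideal. *)
Definition idealX m (i : nat) : {vspace A} :=
  if i is 0 then fullv else (m ^+ i)%VS.

Definition is_socle_degree m (s : nat) : Prop :=
  idealX m s != 0%VS /\ forall j, idealX m j != 0%VS -> (j <= s)%N.

Definition is_hilbert_function m h : Prop :=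
  exists s, [/\ is_socle_degree m s, size h = s.+1
    & forall i, (i <= s)%N ->
        nth 0 h i = (\dim (idealX m i) - \dim (idealX m i.+1))%N].

Definition socle m : {vspace A} := (\bigcap_(y <- vbasis m) lker (amulr y))%VS.

Lemma socleP m x : reflect (forall y, y \in m -> x * y = 0) (x \in socle m).
Proof.
have -> : (x \in socle m) = all (fun y => x * y == 0) (vbasis m).
  rewrite /socle; elim: (tval (vbasis m)) => [|y s IHs].
    by rewrite big_nil memvf.
  by rewrite big_cons memv_cap IHs memv_ker lfunE.
apply: (iffP allP) => [xs0 y /coord_vbasis -> | xm y ys].
  rewrite mulr_sumr big1 // => i _; rewrite -scalerAr.
  by rewrite (eqP (xs0 _ (mem_nth _ _))) ?scaler0 // size_tuple.
by rewrite xm // vbasis_mem.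
Qed.

Definition cm_type m : nat := \dim (socle m).

Definition is_level m (tau : nat) : Prop :=
  exists s, [/\ is_socle_degree m s, socle m = idealX m s
    & \dim (idealX m s) = tau].

Definition is_Gorenstein m : Prop := cm_type m = 1%N.

End ArtinianLocal.

Definition level_Oseq (K : fieldType) (h : seq nat) : Prop :=
  exists (A : falgType K) (m : {vspace A}) (tau : nat),
    [/\ artinian_local A, is_maximal_ideal m,
        is_level m tau & is_hilbert_function m h].

Definition Gorenstein_Oseq (K : fieldType) (h : seq nat) : Prop :=
  exists (A : falgType K) (m : {vspace A}),
    [/\ artinian_local A, is_maximal_ideal m,
        is_Gorenstein m & is_hilbert_function m h].

(** * O-sequences *)

Local Open Scope nat_scope.

(* [c = [:: a_i; a_(i-1); ...; a_j]], so that [j = i - (size c).-1]. *)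
Definition binomial_expansion (i a : nat) (c : seq nat) : Prop :=
  [/\ 0 < size c <= i, sorted gtn c, i - (size c).-1 <= last 0 c
    & a = \sum_(k < size c) 'C(nth 0 c k, i - k)].

(* [b = a^<i>] *)
Definition macaulay_power (i a b : nat) : Prop :=
  exists2 c, binomial_expansion i a c
    & b = \sum_(k < size c) 'C((nth 0 c k).+1, (i - k).+1).

Definition O_sequence (h : seq nat) : Prop :=
  [/\ all (leq 1) h, nth 0 h 0 = 1
    & forall i, 1 <= i -> i.+1 < size h ->
        exists2 b, macaulay_power i (nth 0 h i) b & nth 0 h i.+1 <= b].

(* Main.v *)
Require Import Defs.
From HB Require Import structures.
From mathcomp Require Import all_boot all_order all_algebra all_field.
From mathcomp Require Import boolp mpoly zify.

(** Necessity.  If [m^5 = 0] and the socle is [m^4], multiplication embeds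
    [m^3 / m^4] into [Hom (m / m^2, m^4)], whence [h3 <= 3 h4].  In the Gorenstein
    case, products of [h3] elements of [m] span [m^2] modulo
    [Z = m^2 :&: (0 : m^2)], and the pairing [Z * m -> m^4] gives
    [dim Z <= 3 + 1].

    Sufficiency.  The algebra [A = R / Ann (F_1, ..., F_t)] of a Macaulay inverse
    system (for the contraction action, so that the characteristic plays no role)
    has socle [m^4] of dimension [t] as soon as the degree 4 parts of the [F_j]
    are linearly independent, and [dim m^i] is the rank of the contractions by
    monomials of degree at least [i].  When the [F_j] are sums of distinct
    monomials, chosen so that the distinct nonzero contractions are linearly
    independent, this rank is a mere count.  Such [F_j] exist for all of the
    finitely many admissible [h]. *)

Set Implicit Arguments.
Unset Strict Implicit.
Unset Printing Implicit Defensive.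

Import GRing.Theory.
Local Open Scope ring_scope.

(** * Necessity *)

Section Pairing.
Variables (K : fieldType) (A : falgType K).
Implicit Types (U V P Q : {vspace A}).

(** Rank-nullity, one factor at a time: multiplication by each [y] maps into [V], so passing to its
    kernel costs at most [\dim V] dimensions. *)
Lemma dim_cap_kers U V (ys : seq A) :
    {in U & ys, forall x y, x * y \in V} ->
  (\dim U <= \dim (U :&: \bigcap_(y <- ys) lker (amulr y))
             + size ys * \dim V)%N.
Proof.
elim: ys U => [|y ys IHys] U UyV; first by rewrite big_nil capvf addn0.
rewrite big_cons capvA mulSn -(limg_ker_dim (amulr y) U) addnCA.
rewrite [leqRHS]addnC leq_add //; last first.
  apply/dimvS/subvP=> _ /memv_imgP[x Ux ->].
  by rewrite lfunE /= UyV ?mem_head.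
apply: IHys => x z /memv_capP[Ux _] ys_z.
by rewrite UyV // inE ys_z orbT.
Qed.

(** The product [U * P -> V] factors through [P / Q], so [U] modulo its left kernel embeds in the
    linear maps from [P / Q] to [V]. For an arbitrary subspace [P], [socle P] is the annihilator of
    [P]. *)
Lemma dim_pairing U V P Q :
    (Q <= P)%VS -> (U * P <= V)%VS -> (U * Q = 0)%VS ->
  (\dim U <= \dim (U :&: socle P) + (\dim P - \dim Q) * \dim V)%N.
Proof.
(* A basis of a complement of [Q] in [P] suffices to test annihilation by [P], since [U] kills
   [Q]. *)
move=> sQP UPV UQ0; pose ys : seq A := vbasis (P :\: Q).
have sz_ys : size ys = (\dim P - \dim Q)%N.
  rewrite size_tuple -(dimv_cap_compl P Q) addnC.
  by move/capv_idPr: sQP => ->; rewrite addnK.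
rewrite -sz_ys; apply: leq_trans (dim_cap_kers (V := V) (ys := ys) _) _.
  move=> x y Ux ys_y; apply/(subvP UPV)/memv_mul => //.
  by apply: (subvP (diffvSl P Q)); rewrite (vbasis_mem ys_y).
rewrite leq_add2r; apply/dimvS/subvP=> x /memv_capP[Ux xys].
rewrite memv_cap Ux; apply/socleP=> y.
have -> : P = (P :\: Q + P :&: Q)%VS by rewrite addv_diff_cap.
case/memv_addP=> u Pu [v /memv_capP[_ Qv] ->]; rewrite mulrDr.
have /eqP-> : x * v == 0 by rewrite -memv0 -UQ0 memv_mul.
rewrite addr0 (coord_vbasis Pu) mulr_sumr big1 // => i _.
rewrite -scalerAr; have /subvP/(_ x xys) : (\bigcap_(y <- ys) lker (amulr y)
   <= lker (amulr (vbasis (P :\: Q))`_i))%VS.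
  have : (vbasis (P :\: Q))`_i \in ys by rewrite mem_nth ?size_tuple.
  by move=> ysi; rewrite (big_rem _ ysi) /= capvSl.
by rewrite memv_ker lfunE /= => /eqP->; rewrite scaler0.
Qed.

Hypothesis mulC : commutative (@GRing.mul A).

Lemma prodvC U V : (U * V = V * U)%VS.
Proof.
by apply/eqP; rewrite eqEsubv; apply/andP; split; apply/prodvP=> u v Uu Vv;
   rewrite mulC memv_mul.
Qed.

Lemma dim_sqr_span (s : seq A) : (\dim (<<s>> * <<s>>) <= 'C((size s).+1, 2))%N.
Proof.
elim: s => [|y s IHs]; first by rewrite span_nil prod0v dimv0.
have sub : (<<y :: s>> * <<y :: s>> <= <[y]> * <<y :: s>> + <<s>> * <<s>>)%VS.
  rewrite span_cons prodvDl subv_add addvSl /= prodvDr (prodvC <<s>> <[y]>).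
  by rewrite subv_add addvSr (subv_trans _ (addvSl _ _)) // prodvSr // addvSr.
apply: leq_trans (dimvS sub) _; apply: leq_trans (dimv_add_leqif _ _) _.
(* Pascal's rule: a new generator [y] adds at most one product with each generator, itself
   included. *)
rewrite binS bin1 addnC leq_add //.
apply: leq_trans (dim_prodv _ _) _.
by rewrite dim_vline (leq_trans (leq_mul (leq_b1 _) (leqnn _))) // mul1n dim_span.
Qed.

Lemma dim_sqr U : (\dim (U * U) <= 'C((\dim U).+1, 2))%N.
Proof.
by have := dim_sqr_span (vbasis U); rewrite (span_basis (vbasisP U)) size_tuple.
Qed.

End Pairing.

(** * Bounds on the Hilbert function when the socle is [m^4] *)

Section Necessity.
Variables (K : fieldType) (A : falgType K) (m : {vspace A}).

Lemma artinian_local_mulC : artinian_local A -> commutative (@GRing.mul A).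
Proof.
case=> r [phi phi_surj] x y.
by have [[f <-] [g <-]] := (phi_surj x, phi_surj y); rewrite -!rmorphM mulrC.
Qed.

Hypotheses (localA : artinian_local A) (maxm : is_maximal_ideal m).
Let mulC := artinian_local_mulC localA.

Lemma idealXS i : (idealX m i.+1 <= idealX m i)%VS.
Proof.
have [idm _ _] := maxm; case: i => [|i] /=; first exact: subvf.
elim: i => [|i IHi].
  by rewrite expvSl expv1 (subv_trans _ idm) // prodvSr // subvf.
by rewrite expvSl [X in (_ <= X)%VS]expvSl prodvSr.
Qed.

Lemma idealX_socle s : is_socle_degree m s -> (idealX m s <= socle m)%VS.
Proof.
case=> _ le_s; apply/subvP=> x xs; apply/socleP=> y my.
have /eqP xs1 : idealX m s.+1 == 0%VS.
  by apply: contraT => /le_s; rewrite ltnn.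
apply/eqP; rewrite -memv0 -xs1.
case: s xs {le_s xs1} => [|s] xs /=; last by rewrite expvSr memv_mul.
(* The case [s = 0]: here [idealX m 0] is all of [A], so the ideal property of [m] replaces the
   product of powers. *)
have [idm _ _] := maxm.
by rewrite expv1 mulC (subvP idm) // memv_mul.
Qed.

Variables h1 h2 h3 h4 : nat.
Hypothesis Hm : is_hilbert_function m [:: 1; h1; h2; h3; h4]%N.

Lemma socle_degree4 : is_socle_degree m 4.
Proof. by case: Hm => s [sd [es] _]; rewrite -es in sd. Qed.

Lemma idealX5 : (m ^+ 5 = 0)%VS.
Proof.
case: socle_degree4 => _ le4; apply/eqP/contraT => m5.
by have := le4 5 m5.
Qed.

(** The powers of [m] decrease, so the truncated differences are genuine and telescope from
    [m^5 = 0]. *)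
Lemma hilbert_dims :
  [/\ \dim (m ^+ 4)%VS = h4, \dim (m ^+ 3)%VS = (h3 + h4)%N,
      \dim (m ^+ 2)%VS = (h2 + h3 + h4)%N & \dim m = (h1 + h2 + h3 + h4)%N].
Proof.
case: Hm => s [_ [es] hE]; rewrite -es in hE.
have le i := dimvS (idealXS i).
have := And4 (hE 1%N isT) (hE 2%N isT) (hE 3%N isT) (hE 4%N isT).
have := And3 (le 1%N) (le 2%N) (le 3%N).
by rewrite /= idealX5 dimv0 expv1 => -[? ? ?] [? ? ? ?]; split; lia.
Qed.

Hypothesis socm : socle m = (m ^+ 4)%VS.

Lemma expv2_sub : (m ^+ 2 <= m)%VS.
Proof. by have := idealXS 1; rewrite /= expv1. Qed.

Lemma hilbert3_le : (h3 <= h1 * h4)%N.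
Proof.
have [d4 d3 d2 d1] := hilbert_dims.
have := dim_pairing (U := (m ^+ 3)%VS) (V := (m ^+ 4)%VS) expv2_sub.
rewrite -expvSr -expvD subvv idealX5 => /(_ isT erefl).
have := dimvS (capvSr (m ^+ 3)%VS (socle m)).
rewrite {2}socm d1 d2 d3 d4; nia.
Qed.

(* [N] is the part of [m] killing [m^3]; it has codimension at most [h3], and
   [N m] lies in [Z], the part of [m^2] killing [m^2].  Hence [m^2] is spanned
   modulo [Z] by products of [h3] elements, while [Z] pairs with [m / m^2]. *)
Lemma hilbert2_le : h4 = 1%N -> (h2 <= 'C(h3.+1, 2) + (h1 - h3))%N.
Proof.
move=> h41; have [d4 d3 d2 d1] := hilbert_dims; have h3h1 := hilbert3_le.
pose N := (m :&: socle (m ^+ 3))%VS; pose Y := (m :\: N)%VS.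
pose Z := (m ^+ 2 :&: socle (m ^+ 2))%VS.
have mYN : m = (Y + N)%VS.
  by rewrite -{1}(addv_diff_cap m N) (capv_idPr (capvSl _ _)).
(* The pairing of [m] with [m^3 / m^4] takes values in the line [m^4], and its left kernel is
   [N]. *)
have dimY : (\dim Y <= h3)%N.
  have := dim_pairing (U := m) (V := (m ^+ 4)%VS) (idealXS 3).
  rewrite /= -!expvSl subvv idealX5 => /(_ isT erefl); rewrite -/N.
  have := dimv_cap_compl m N; rewrite (capv_idPr (capvSl _ _)) -/Y.
  by rewrite -/N d1 d3 d4 h41; lia.
have dimZ : (\dim Z <= h1 + h4)%N.
  have Zm : (Z * m <= m ^+ 4)%VS.
    rewrite -socm; apply/prodvP=> z x /memv_capP[_ /socleP z2] mx.
    by apply/socleP=> y my; rewrite -mulrA z2 // expv2 memv_mul.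
  have Zm2 : (Z * m ^+ 2 = 0)%VS.
    apply/eqP; rewrite -subv0; apply/prodvP=> z x /memv_capP[_ /socleP z2] mx.
    by rewrite z2 ?mem0v.
  have := dim_pairing expv2_sub Zm Zm2; have := dimvS (capvSr Z (socle m)).
  rewrite {2}socm d1 d2 d4 h41; lia.
have NmZ : (N * m <= Z)%VS.
  apply/prodvP=> x y /memv_capP[mx /socleP x3] my.
  rewrite memv_cap expv2 memv_mul //=; apply/socleP=> z mz.
  by rewrite -mulrA x3 // expvSl memv_mul.
have m2YZ : (m ^+ 2 <= Y * Y + Z)%VS.
  rewrite expv2 {1}mYN prodvDl subv_add; apply/andP; split; last first.
    exact: subv_trans NmZ (addvSr _ _).
  rewrite {1}mYN prodvDr subv_add addvSl /=.
  apply: subv_trans (addvSr _ _); apply: subv_trans NmZ.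
  by rewrite prodvC // prodvSr // diffvSl.
have := leq_trans (dimvS m2YZ) (dimv_add_leqif _ _).
have := leq_trans (dim_sqr mulC Y) (leq_bin2l 2 (dimY : (_.+1 <= _.+1)%N)).
(* The bound [h3 <= h1] makes the subtraction in the goal a genuine one. *)
rewrite h41 muln1 in h3h1 dimZ *; rewrite d2 h41 => YY2 YYZ.
by have := leq_trans YYZ (leq_add YY2 dimZ); lia.
Qed.

End Necessity.

Lemma level_hilbert3_le (K : fieldType) h1 h2 h3 h4 :
  level_Oseq K [:: 1; h1; h2; h3; h4]%N -> (h3 <= h1 * h4)%N.
Proof.
case=> A [m] [tau] [localA maxm [s [sd socm _]] Hm].
apply: (hilbert3_le maxm Hm); rewrite socm.
suff -> : s = 4 by [].
have [/sd.2 le4s le4] := socle_degree4 Hm.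
by apply/eqP; rewrite eqn_leq le4s le4 // sd.1.
Qed.

(** The socle contains [m^4], and both have dimension 1, so they coincide. *)
Lemma Gorenstein_hilbert_le (K : fieldType) h1 h2 h3 :
    Gorenstein_Oseq K [:: 1; h1; h2; h3; 1]%N ->
  (h3 <= h1 /\ h2 <= 'C(h3.+1, 2) + (h1 - h3))%N.
Proof.
case=> A [m] [localA maxm Gm Hm].
have socm : socle m = (m ^+ 4)%VS.
  apply/esym/eqP.
  rewrite eqEdim (idealX_socle localA maxm (socle_degree4 Hm)) -/(cm_type m) Gm.
  by case: (hilbert_dims maxm Hm) => ->.
split; last exact: (hilbert2_le localA maxm Hm socm).
by rewrite -[h1]muln1 (hilbert3_le maxm Hm).
Qed.

(** * Macaulay inverse systems *)

(** Transport of structure: the quotient of [R] by the ideal [ker pi] is built on the space [V],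
    with products computed on representatives chosen by [sec]. The map [iota] is the identity, read
    as a linear map from the new algebra back to [V]. *)
Lemma quotient_falg (K : fieldType) (R : comAlgType K) (V : vectType K)
    (pi : {linear R -> V}) :
    (forall v, exists f, pi f = v) -> pi 1 != 0 ->
    (forall f g, pi f = 0 -> pi (f * g) = 0) ->
  exists (A : falgType K) (phi : {lrmorphism R -> A}) (iota : 'Hom(A, V)),
    lker iota == 0%VS /\ forall f, iota (phi f) = pi f.
Proof.
move=> pi_surj pi1 pi_ideal.
pose sec v := sval (cid (pi_surj v)).
have secK v : pi (sec v) = v by rewrite /sec; case: cid.
have piMl f f' g : pi f = pi f' -> pi (f * g) = pi (f' * g).
  move=> eqf; apply/eqP; rewrite -subr_eq0 -linearB -mulrBl /=.
  by rewrite pi_ideal // linearB /= eqf subrr.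
have piMr f g g' : pi g = pi g' -> pi (f * g) = pi (f * g').
  by rewrite ![f * _]mulrC; apply: piMl.
pose mul u v := pi (sec u * sec v).
have piM f g : pi (f * g) = mul (pi f) (pi g).
  by rewrite (@piMl _ (sec (pi f))) ?secK // (@piMr _ _ (sec (pi g))) ?secK.
have mulA : associative mul.
  by move=> u v w; rewrite -[u]secK -[v]secK -[w]secK -!piM mulrA.
have mul1 : left_id (pi 1) mul.
  by move=> u; rewrite -[u]secK -piM mul1r.
have mulr1 : right_id (pi 1) mul.
  by move=> u; rewrite -[u]secK -piM mulr1.
have mulDl : left_distributive mul +%R.
  move=> u v w; rewrite -[u]secK -[v]secK -[w]secK -linearD -!piM mulrDl.
  by rewrite linearD.
have mulDr : right_distributive mul +%R.
  move=> u v w; rewrite -[u]secK -[v]secK -[w]secK -linearD -!piM mulrDr.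
  by rewrite linearD.
have scAl (c : K) u v : c *: mul u v = mul (c *: u) v.
  by rewrite -[u]secK -[v]secK -piM -!linearZ_LR -piM scalerAl.
have scAr (c : K) u v : c *: mul u v = mul u (c *: v).
  by rewrite -[u]secK -[v]secK -piM -!linearZ_LR -piM scalerAr.
pose ring_mixin := GRing.Zmodule_isNzRing.Build V mulA mul1 mulr1 mulDl mulDr pi1.
pose B0 : nzRingType := HB.pack V ring_mixin.
pose B1 : lalgType K := HB.pack V ring_mixin (GRing.Lmodule_isLalgebra.Build K B0 scAl).
pose B2 : algType K := HB.pack V B1 (GRing.Lalgebra_isAlgebra.Build K B1 scAr).
pose A : falgType K := HB.pack V B2 (Algebra_isFalgebra.Build K B2).
have pi_lin : linear (pi : R -> A) by move=> c f g; rewrite linearP.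
have pi_mon : monoid_morphism (pi : R -> A) by split=> // f g; apply: piM.
pose phi : {lrmorphism R -> A} := HB.pack (pi : R -> A)
  (GRing.isLinear.Build K R A *:%R (pi : R -> A) pi_lin)
  (GRing.isMonoidMorphism.Build R A (pi : R -> A) pi_mon).
have id_lin : linear (id : A -> V) by [].
pose idl : {linear A -> V} := HB.pack (id : A -> V)
  (GRing.isLinear.Build K A V *:%R (id : A -> V) id_lin).
exists A, phi, (linfun idl); split=> [|f]; last by rewrite lfunE.
by apply/lker0P=> u v; rewrite !lfunE.
Qed.

(** * Monomials as power series *)

Section FpsMonomials.
Variables (n : nat) (R : comNzRingType).

Definition fpsX (m : 'X_{1..n}) : {fps R[n]} := FPS (fun k => (k == m)%:R).

(** With the condition on the indices turned into a factor and a bound [d] independent of [k], sums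
    over several indices can be exchanged. *)
Lemma fpscoefM (f g : {fps R[n]}) d k : (mdeg k < d)%N ->
  fpscoef (f * g) k = \sum_(k1 : 'X_{1..n < d}) \sum_(k2 : 'X_{1..n < d})
    fpscoef f k1 * fpscoef g k2 * (k == k1 + k2)%MM%:R.
Proof.
move=> /(fps_mulE f g) ->.
rewrite /fps_trunc mulr_suml raddf_sum /=; apply: eq_bigr => k1 _.
rewrite mulr_sumr raddf_sum /=; apply: eq_bigr => k2 _.
rewrite -scalerAl -scalerAr -mpolyXD scalerA mcoeffZ mcoeffX.
by rewrite eq_sym.
Qed.

Lemma fpsXM m1 m2 : fpsX m1 * fpsX m2 = fpsX (m1 + m2).
Proof.
apply/fpsP=> k.
set d := (mdeg k + mdeg m1 + mdeg m2).+1.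
have ltk : (mdeg k < d)%N by rewrite ltnS -addnA leq_addr.
have lt1 : (mdeg m1 < d)%N by rewrite ltnS addnAC leq_addl.
have lt2 : (mdeg m2 < d)%N by rewrite ltnS leq_addl.
rewrite (fpscoefM _ _ ltk) (bigD1 (BMultinom lt1)) //= [X in _ + X]big1 ?addr0.
  rewrite (bigD1 (BMultinom lt2)) //= [X in _ + X]big1 ?addr0.
    by rewrite !eqxx !mul1r.
  by move=> k2 /negbTE; rewrite bmeqP /= => ->; rewrite mulr0 mul0r.
move=> k1 /negbTE; rewrite bmeqP /= => ->.
by rewrite big1 // => k2 _; rewrite !mul0r.
Qed.

Lemma fpsX0 : fpsX 0 = 1.
Proof. by []. Qed.

End FpsMonomials.

(** * Contraction, and the quotient by the annihilator of an inverse system *)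

Section InverseSystem.
Variables (K : fieldType) (r d : nat) (T : vectType K) (F : 'X_{1..r} -> T).
Hypothesis F0 : forall m, (d < mdeg m)%N -> F m = 0.
Implicit Types (f g : {fps K[r]}) (m u : 'X_{1..r}).

(* The coefficient at [u] of the contraction of the inverse system [F] by [f]. *)
Definition contract_at f u : T :=
  \sum_(m : 'X_{1..r < d.+1}) fpscoef f m *: F (m + u)%MM.

(** Bounding the degree of [u] makes the target finite-dimensional; by [contract_at_deg] only zeros
    are lost. *)
Definition contract f : {ffun 'X_{1..r < d.+1} -> T} :=
  [ffun u : 'X_{1..r < d.+1} => contract_at f u].

Lemma sum_fpsX (G : 'X_{1..r} -> T) m :
    (forall k, (d < mdeg k)%N -> G k = 0) ->
  \sum_(k : 'X_{1..r < d.+1}) fpscoef (fpsX K m) k *: G k = G m.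
Proof.
move=> G0; have [ltm | lemd] := ltnP (mdeg m) d.+1.
  rewrite (bigD1 (BMultinom ltm)) //= eqxx scale1r big1 ?addr0 // => k.
  by rewrite bmeqP /= => /negbTE->; rewrite scale0r.
rewrite G0 // big1 // => k _ /=.
rewrite [bmnm k == m](introF eqP) ?scale0r // => eqm.
by have := bmdeg k; rewrite eqm ltnNge lemd.
Qed.

Lemma contract_at_deg f u : (d < mdeg u)%N -> contract_at f u = 0.
Proof.
move=> ltdu; rewrite /contract_at big1 // => m _.
by rewrite F0 ?scaler0 // mdegD ltn_addl.
Qed.

Lemma contract_atX m u : contract_at (fpsX K m) u = F (m + u)%MM.
Proof.
rewrite -(@sum_fpsX (fun k => F (k + u)%MM)) // => k ltdk.
by rewrite F0 // mdegD ltn_addr.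
Qed.

(** Contraction is a module action: contracting by [f * g] is contracting by [f], then by [g]. Hence
    the kernel of [contract] is an ideal. *)
Lemma contract_atM f g u : contract_at (f * g) u =
  \sum_(v : 'X_{1..r < d.+1}) fpscoef g v *: contract_at f (v + u)%MM.
Proof.
under eq_bigr do rewrite /contract_at scaler_sumr.
rewrite /contract_at exchange_big.
under [LHS]eq_bigr => m _ do rewrite (fpscoefM f g (bmdeg m)) scaler_suml.
rewrite [LHS]exchange_big; apply: eq_bigr => k1 _.
under [LHS]eq_bigr => m _ do rewrite scaler_suml.
rewrite [LHS]exchange_big; apply: eq_bigr => k2 _.
rewrite scalerA [fpscoef g k2 * _]mulrC.
have [ltk | lek] := ltnP (mdeg (k1 + k2)%MM) d.+1.
  rewrite (bigD1 (BMultinom ltk)) //= eqxx mulr1 addmA big1 ?addr0 // => m.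
  by rewrite bmeqP /= => /negbTE->; rewrite mulr0 scale0r.
(* A product of degree above [d] is absent from the left sum, and [F] vanishes there on the
   right. *)
rewrite addmA [F _]F0 ?scaler0; last by rewrite mdegD ltn_addr.
rewrite big1 // => m _.
rewrite [bmnm m == _](introF eqP) ?mulr0 ?scale0r // => eqm.
by have := bmdeg m; rewrite eqm ltnNge lek.
Qed.

Lemma contract_atMX f m u :
  contract_at (f * fpsX K m) u = contract_at f (m + u)%MM.
Proof.
rewrite contract_atM -(@sum_fpsX (fun k => contract_at f (k + u)%MM)) // => k ltdk.
by rewrite contract_at_deg // mdegD ltn_addr.
Qed.

Lemma contract_at0 f u : contract f = 0 -> contract_at f u = 0.
Proof.
move=> /ffunP f0; have [ltu | leu] := ltnP (mdeg u) d.+1.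
  by have := f0 (BMultinom ltu); rewrite !ffunE.
exact: contract_at_deg.
Qed.

Lemma contractM0 f g : contract f = 0 -> contract (f * g) = 0.
Proof.
move=> f0; apply/ffunP=> u; rewrite !ffunE contract_atM big1 // => v _.
by rewrite contract_at0 // scaler0.
Qed.

Lemma contract_is_linear : linear contract.
Proof.
move=> c f g; apply/ffunP=> u; rewrite !ffunE /contract_at scaler_sumr.
by rewrite -big_split; apply: eq_bigr => m _ /=; rewrite scalerDl scalerA.
Qed.

HB.instance Definition _ := GRing.isLinear.Build K {fps K[r]}
  {ffun 'X_{1..r < d.+1} -> T} *:%R contract contract_is_linear.

Lemma contractE f : contract f =
  \sum_(m : 'X_{1..r < d.+1}) fpscoef f m *: contract (fpsX K m).
Proof.
apply/ffunP=> u; rewrite sum_ffunE ffunE; apply: eq_bigr => m _.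
by rewrite !ffunE contract_atX.
Qed.

Let U := (\sum_(m : 'X_{1..r < d.+1}) <[contract (fpsX K m)]>)%VS.

(** This is [quotient_falg] for contraction onto its image [U]; the kernel is the annihilator of the
    inverse system. *)
Lemma inverse_system_algebra : (exists m, F m != 0) ->
  exists (A : falgType K) (phi : {lrmorphism {fps K[r]} -> A})
         (iota : 'Hom(A, {ffun 'X_{1..r < d.+1} -> T})),
    [/\ lker iota == 0%VS, forall f, iota (phi f) = contract f
      & forall a, exists f, phi f = a].
Proof.
case=> m0 Fm0.
have contrU f : contract f \in U.
  rewrite contractE memv_sumr // => m _; exact/memvZ/memv_line.
pose pi : {linear {fps K[r]} -> subvs_of U} := vsproj U \o contract.
have piE f : vsval (pi f) = contract f by rewrite /pi /= vsprojK.
have pi_surj v : exists f, pi f = v.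
  have /memv_sumP[w wX vE] := subvsP v.
  have /choice[c cE] (m : 'X_{1..r < d.+1}) : exists c, w m = c *: contract (fpsX K m).
    exact/vlineP/wX.
  exists (\sum_(m : 'X_{1..r < d.+1}) c m *: fpsX K m).
  apply: val_inj; rewrite /= piE linear_sum vE; apply: eq_bigr => m _ /=.
  by rewrite linearZ cE.
(* If [1] were killed, so would be the monomial [m0], whose contraction has the value [F m0] at
   [0]. *)
have pi1 : pi 1 != 0.
  apply: contra Fm0 => /eqP/(congr1 vsval); rewrite piE linear0 => c0.
  by rewrite -[m0]addm0 -contract_atX contract_at0 // -[fpsX _ _]mul1r contractM0.
have pi_ideal f g : pi f = 0 -> pi (f * g) = 0.
  move=> /(congr1 vsval); rewrite piE linear0 => f0.
  by apply: val_inj; rewrite /= piE contractM0 ?linear0.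
have [A [phi [iota [kiota iotaE]]]] := quotient_falg pi_surj pi1 pi_ideal.
exists A, phi, (linfun vsval \o iota)%VF; split=> [|f|a].
- apply/lker0P=> a b; rewrite !comp_lfunE !lfunE /= => /val_inj.
  exact/(lker0P kiota).
- by rewrite comp_lfunE lfunE /= iotaE piE.
- have [f fE] := pi_surj (iota a); exists f; apply/(lker0P kiota).
  by rewrite iotaE.
Qed.

End InverseSystem.

(** * The maximal ideal, its powers and the socle of the algebra *)

Section InverseSystemAlgebra.
Variables (K : fieldType) (r d : nat) (T : vectType K) (F : 'X_{1..r} -> T).
Hypothesis F0 : forall m, (d < mdeg m)%N -> F m = 0.
Variables (A : falgType K) (phi : {lrmorphism {fps K[r]} -> A}).
Variable iota : 'Hom(A, {ffun 'X_{1..r < d.+1} -> T}).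
Hypothesis kiota : lker iota == 0%VS.
Hypothesis iotaE : forall f, iota (phi f) = contract d F f.
Hypothesis phi_surj : forall a, exists f, phi f = a.

Let mon (m : 'X_{1..r}) : A := phi (fpsX K m).

Definition deg_ideal i : {vspace A} :=
  (\sum_(m : 'X_{1..r < d.+1} | (i <= mdeg m)%N) <[mon m]>)%VS.

Local Notation M := deg_ideal.

Lemma iota_mon m u : iota (mon m) u = F (m + u)%MM.
Proof. by rewrite iotaE ffunE contract_atX. Qed.

Lemma monM m1 m2 : mon m1 * mon m2 = mon (m1 + m2)%MM.
Proof. by rewrite -rmorphM fpsXM. Qed.

Lemma mon_deg0 m : (d < mdeg m)%N -> mon m = 0.
Proof.
move=> ltdm; apply/(lker0P kiota); rewrite linear0; apply/ffunP=> u.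
by rewrite iota_mon ffunE F0 // mdegD ltn_addr.
Qed.

Lemma mem_deg_ideal i m : (i <= mdeg m)%N -> mon m \in M i.
Proof.
move=> leim; have [ltmd | ] := ltnP (mdeg m) d.+1; last by move/mon_deg0->; apply: mem0v.
by rewrite memvE (sumv_sup (BMultinom ltmd)).
Qed.

Lemma deg_ideal_sub i (V : {vspace A}) :
  (forall m, (i <= mdeg m)%N -> (mdeg m <= d)%N -> mon m \in V) -> (M i <= V)%VS.
Proof.
move=> MV; apply/subv_sumP=> m leim; rewrite -memvE.
by apply: MV; rewrite // -ltnS bmdeg.
Qed.

Lemma deg_ideal0 : M 0 = fullv.
Proof.
apply/eqP; rewrite eqEsubv subvf; apply/subvP=> a _; have [f <-] := phi_surj a.
have -> : phi f = \sum_(m : 'X_{1..r < d.+1}) fpscoef f m *: mon m.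
  apply/(lker0P kiota); rewrite [RHS]linear_sum iotaE contractE //=.
  by apply: eq_bigr => m _; rewrite linearZ /= iotaE.
by apply: memv_suml => m _; apply/memvZ/mem_deg_ideal.
Qed.

Lemma deg_ideal_eq0 i : (d < i)%N -> M i = 0%VS.
Proof.
move=> ltdi; apply/eqP; rewrite -subv0; apply: deg_ideal_sub => m leim lemd.
by rewrite mon_deg0 ?mem0v // (leq_trans ltdi).
Qed.

Lemma deg_idealM i j : (M i * M j <= M (i + j))%VS.
Proof.
rewrite big_distrlr /=; apply/subv_sumP=> m1 le1; apply/subv_sumP=> m2 le2.
by rewrite prodv_line monM -memvE mem_deg_ideal // mdegD leq_add.
Qed.

(** A monomial of positive degree is a variable times a monomial of degree one less. *)
Lemma deg_idealX i : (M 1 ^+ i.+1 = M i.+1)%VS.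
Proof.
elim: i => [|i IHi]; first by rewrite expv1.
apply/eqP; rewrite expvSl IHi eqEsubv deg_idealM /=; apply: deg_ideal_sub => m lem _.
have [j mj] : exists j, (0 < m j)%N.
  apply/existsP; apply: contraLR lem; rewrite negb_exists => /forallP m0.
  by rewrite -ltnNge mdegE big1 // => j _; have := m0 j; case: (m j).
have mE : m = (U_(j) + (m - U_(j)))%MM.
  apply/mnmP=> k; rewrite mnmDE mnmBE mnm1E.
  by case: eqP => [<-|_]; rewrite ?subn0 // subnKC.
move: lem; rewrite mE mdegD mdeg1 ltnS -monM => lem.
by rewrite memv_mul ?mem_deg_ideal ?mdeg1.
Qed.

Lemma idealX_deg_ideal i : idealX (M 1) i = M i.
Proof. by case: i => [|i]; rewrite /= ?deg_ideal0 ?deg_idealX. Qed.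

(** As row rank equals column rank, this says that the degree [d] parts of the components of [F] are
    linearly independent. *)
Hypothesis topF : (fullv <= \sum_(m : 'X_{1..r < d.+1} | mdeg m == d) <[F m]>)%VS.
Hypothesis T_gt0 : (0 < dim T)%N.

Lemma deg_ideal_top_neq0 : M d != 0%VS.
Proof.
apply: contraTneq T_gt0 => Md0; rewrite -dimvf -eqn0Ngt dimv_eq0.
rewrite -subv0 (subv_trans topF) //; apply/subv_sumP=> m /eqP mE; rewrite -memvE.
have /eqP xm0 : mon m == 0 by rewrite -memv0 -Md0 mem_deg_ideal ?mE.
have := iota_mon m bm0.
by rewrite xm0 linear0 ffunE addm0 => <-; apply: mem0v.
Qed.

Lemma deg_ideal_is_ideal i : is_ideal (M i).
Proof. by rewrite /is_ideal -deg_ideal0 -{2}[i]addn0 deg_idealM. Qed.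

(** Otherwise all [M i] would be the whole algebra, whereas [M d.+1 = 0]. *)
Lemma deg_ideal1_proper : M 1 != fullv.
Proof.
apply: contraNneq deg_ideal_top_neq0 => M1f.
have Mf i : M i = fullv.
  elim: i => [|i IHi]; first exact: deg_ideal0.
  apply/eqP; rewrite eqEsubv subvf -{1}IHi -addn1 (subv_trans _ (deg_idealM _ _)) //.
  apply/subvP=> a Ma; rewrite -[a]mulr1 memv_mul //.
  by rewrite M1f memvf.
by rewrite [M d]Mf -(Mf d.+1) deg_ideal_eq0.
Qed.

(** The algebra is the sum of the constants and [M 1], so an ideal strictly above [M 1] contains a
    nonzero constant. *)
Lemma deg_ideal1_maximal : is_maximal_ideal (M 1).
Proof.
split=> [||J idJ M1J]; [exact: deg_ideal_is_ideal | exact: deg_ideal1_proper|].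
have full1 : (fullv <= <[1%R]> + M 1)%VS.
  rewrite -deg_ideal0; apply: deg_ideal_sub => m _ _; have [m0 | m_gt0] := posnP (mdeg m).
    move/eqP: m0; rewrite mdeg_eq0 => /eqP->; rewrite /mon fpsX0 rmorph1.
    by apply: (subvP (addvSl _ _)); apply: memv_line.
  by apply: (subvP (addvSr _ _)); apply: mem_deg_ideal.
case: (boolP (1 \in J)) => [J1 | NJ1]; [right | left].
  apply/eqP; rewrite eqEsubv subvf (subv_trans full1) //.
  by rewrite subv_add M1J -memvE J1.
apply/eqP; rewrite eqEsubv M1J andbT; apply/subvP=> a Ja.
have /memv_addP[_ /vlineP[c ->] [b M1b aE]] := subvP full1 a (memvf a).
have [c0 | c_neq0] := eqVneq c 0; first by rewrite aE c0 scale0r add0r.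
case/negP: NJ1; rewrite -[1%R](scalerK c_neq0) memvZ //.
have -> : c *: 1 = a - b by rewrite aE addrK.
by rewrite memvB // (subvP M1J).
Qed.

(* Contraction by a socle element has only a constant term, and the forms of degree
   [d] already produce all constants. *)
Lemma socle_deg_ideal1 : socle (M 1) = M d.
Proof.
apply/eqP; rewrite eqEsubv; apply/andP; split; apply/subvP=> a; last first.
  move=> Md_a; apply/socleP=> b M1b; apply/eqP; rewrite -memv0 -(deg_ideal_eq0 (ltnSn d)).
  by rewrite -addn1 (subvP (deg_idealM _ _)) // memv_mul.
move=> /socleP soc_a; have [f fE] := phi_surj a.
have f0 u : (0 < mdeg u)%N -> contract_at d F f u = 0.
  move=> u_gt0; have := soc_a (mon u) (mem_deg_ideal u_gt0).
  rewrite -fE -rmorphM => /(congr1 (fun b => iota b bm0)).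
  by rewrite iotaE linear0 !ffunE contract_atMX // addm0.
have /memv_sumP[w wF tE] := subvP topF (contract_at d F f 0) (memvf _).
have /choice[c cE] (m : 'X_{1..r < d.+1}) :
    exists c, mdeg m == d -> w m = c *: F m.
  case: (boolP (mdeg m == d)) => [/wF/vlineP[c ->] | _]; last by exists 0.
  by exists c.
have -> : a = \sum_(m : 'X_{1..r < d.+1} | mdeg m == d) c m *: mon m.
  apply/(lker0P kiota)/ffunP=> u; rewrite -fE iotaE ffunE linear_sum sum_ffunE.
  have [u0 | u_gt0] := posnP (mdeg u); last first.
    rewrite f0 // big1 // => m /eqP mE; rewrite linearZ /= ffunE iota_mon.
    by rewrite F0 ?scaler0 // mdegD mE -{1}[d]addn0 ltn_add2l.
  have -> : u = bm0 by apply/eqP; rewrite bmeqP /= -mdeg_eq0 u0.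
  rewrite tE; apply: eq_bigr => m /cE->.
  by rewrite linearZ /= ffunE iota_mon /= addm0.
by apply: memv_suml => m /eqP mE; rewrite memvZ // mem_deg_ideal ?mE.
Qed.

Lemma dim_deg_ideal i : \dim (M i) =
  \dim (\sum_(m : 'X_{1..r < d.+1} | (i <= mdeg m)%N)
          <[contract d F (fpsX K m)]>).
Proof.
rewrite -(limg_dim_eq (f := iota)) ?(eqP kiota) ?capv0 // limg_sum.
by congr (\dim _); apply: eq_bigr => m _; rewrite limg_line iotaE.
Qed.

End InverseSystemAlgebra.

Lemma inverse_system_level (K : fieldType) (r d : nat) (T : vectType K)
    (F : 'X_{1..r} -> T) :
    (0 < dim T)%N -> (forall m, (d < mdeg m)%N -> F m = 0) ->
    (fullv <= \sum_(m : 'X_{1..r < d.+1} | mdeg m == d) <[F m]>)%VS ->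
  exists (A : falgType K) (m : {vspace A}),
    [/\ artinian_local A, is_maximal_ideal m, is_socle_degree m d,
        socle m = idealX m d
      & forall i, \dim (idealX m i) =
          \dim (\sum_(m : 'X_{1..r < d.+1} | (i <= mdeg m)%N)
                  <[contract d F (fpsX K m)]>)].
Proof.
move=> T_gt0 F0 topF.
have exF : exists m, F m != 0.
  apply/not_existsP => F_eq0.
  move: T_gt0; rewrite -dimvf lt0n dimv_eq0 => /negP[]; rewrite -subv0.
  apply: subv_trans topF _; apply/subv_sumP=> m _; rewrite -memvE.
  by have /negP := F_eq0 m; rewrite negbK => /eqP->; apply: mem0v.
have [A [phi [iota [kiota iotaE phi_surj]]]] := inverse_system_algebra F0 exF.
have idX i := idealX_deg_ideal F0 kiota iotaE phi_surj i.
exists A, (deg_ideal d phi 1); split.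
- by exists r, phi.
- exact: (deg_ideal1_maximal F0 kiota iotaE phi_surj topF T_gt0).
- split; first by rewrite idX (deg_ideal_top_neq0 F0 kiota iotaE topF T_gt0).
  move=> j; apply: contraNT; rewrite -ltnNge => ltdj.
  by rewrite idX (deg_ideal_eq0 F0 kiota iotaE).
- by rewrite idX (socle_deg_ideal1 F0 kiota iotaE phi_surj topF).
- by move=> i; rewrite idX (dim_deg_ideal kiota iotaE).
Qed.

(** * Inverse systems given by labelled monomials *)

(** Exponent vectors are plain lists here, so that the final check can run by computation. *)
Fixpoint exponents (r d : nat) : seq (seq nat) :=
  if r is r'.+1 then
    [seq a :: e | a <- iota 0 d.+1, e <- exponents r' (d - a)]
  else [:: [::]].

Definition addexp (e u : seq nat) : seq nat := [seq p.1 + p.2 | p <- zip e u]%N.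

Lemma exponentsS r d : exponents r.+1 d =
  [seq a :: e | a <- iota 0 d.+1, e <- exponents r (d - a)].
Proof. by []. Qed.

Lemma mem_exponents r d e :
  (e \in exponents r d) = (size e == r) && (sumn e <= d)%N.
Proof.
elim: r d e => [|r IHr] d e; first by rewrite inE; case: e.
rewrite exponentsS; apply/allpairsPdep/idP => [[a [u [+ + ->]]]|].
  rewrite mem_iota ltnS => /= lead; rewrite IHr eqSS => /andP[-> /=].
  by rewrite leq_subRL.
case: e => // a e; rewrite eqSS => /andP[sz le_d].
have lead : (a <= d)%N := leq_trans (leq_addr _ _) le_d.
exists a, e; split=> //; first by rewrite mem_iota ltnS.
by rewrite IHr sz leq_subRL.
Qed.

Lemma exponents_uniq r d : uniq (exponents r d).
Proof.
elim: r d => // r IHr d; rewrite exponentsS; apply: allpairs_uniq_dep => //; first exact: iota_uniq.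
by move=> [a e] [b u] _ _ /= [-> ->].
Qed.

Lemma exponents_mnm r d e : e \in exponents r d ->
  exists u : 'X_{1..r < d.+1}, u = e :> seq nat.
Proof.
rewrite mem_exponents => /andP[sz led].
have ltu : (mdeg [multinom Tuple sz] < d.+1)%N by rewrite /mdeg -sumnE.
by exists (BMultinom ltu).
Qed.

(** * Ranks of contractions read off from labels *)

Section Labels.
Variables (r d t : nat) (lam : seq nat -> nat).

(** A row of the catalecticant matrix of the inverse system, with labels as entries. *)
Definition label_row (e : seq nat) : seq nat :=
  [seq lam (addexp e u) | u <- exponents r d].

Definition label_rows (i : nat) : seq (seq nat) :=
  undup [seq s <- [seq label_row e | e <- exponents r d & (i <= sumn e)%N]
        | has (leq 1) s].

(* A row with a nonzero label not shared by any other row in the same column has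
   coefficient zero in every linear relation.  Nested [if]s, because [&&] and [||]
   evaluate both arguments under call by value. *)
Definition isolated (S : seq (seq nat)) (s : seq nat) : bool :=
  has (fun k => if nth 0 s k == 0 then false else
         all (fun s' => if nth 0 s' k == nth 0 s k then s' == s else true) S)%N
    (iota 0 (size s)).

(** Isolated rows are discarded round after round, with fuel [n]; reaching the empty list certifies
    linear independence. *)
Fixpoint peelable (n : nat) (S : seq (seq nat)) : bool :=
  (S == [::]) ||
  (if n is n'.+1 then peelable n' [seq s <- S | ~~ isolated S s] else false).

(** The fourth clause puts every label in degree [d], which yields the spanning hypothesis of
    [inverse_system_level]; the last one turns the row counts of the second into ranks. *)
Definition realizes (h : seq nat) : bool :=
  [&& size h == d.+1,
      all (fun i => nth 0%N h i == size (label_rows i) - size (label_rows i.+1))%N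
        (iota 0 d.+1),
      (0 < t)%N,
      all (fun j => has (fun e => (sumn e == d) && (lam e == j)) (exponents r d))
        (iota 1 t)
    & peelable (size (label_rows 0)) (label_rows 0)].

Hypothesis lam_le : forall e, (lam e <= t)%N.
Hypothesis lam0 : forall e, (d < sumn e)%N -> lam e = 0%N.

Variable K : fieldType.

Definition label_vec (j : nat) : 'rV[K]_t := \row_(k < t) (j == k.+1)%:R.

(* The inverse system [F_1, ..., F_t], where [F_j] is the sum of the monomials
   labelled [j], as the vector of coefficients at [m]; label [0] means that the
   monomial occurs in no [F_j]. *)
Definition label_form (m : 'X_{1..r}) : 'rV[K]_t := label_vec (lam m).

Let W := {ffun 'X_{1..r < d.+1} -> 'rV[K]_t}.

Definition row_vec (s : seq nat) : W :=
  [ffun u : 'X_{1..r < d.+1} => label_vec (nth 0%N s (index (u : seq nat) (exponents r d)))].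

Lemma label_vec0 : label_vec 0 = 0.
Proof. by apply/rowP=> k; rewrite !mxE. Qed.

Lemma sumn_mdeg (m : 'X_{1..r}) : sumn m = mdeg m.
Proof. by rewrite /mdeg sumnE. Qed.

Lemma mem_exponents_mnm (u : 'X_{1..r < d.+1}) : (u : seq nat) \in exponents r d.
Proof. by rewrite mem_exponents size_tuple eqxx sumn_mdeg -ltnS bmdeg. Qed.

Lemma addexp_mnm (m u : 'X_{1..r}) : addexp m u = (m + u)%MM.
Proof.
apply: (@eq_from_nth _ 0%N) => [|i]; rewrite size_map size_zip !size_tuple minnn // => ltir.
rewrite (nth_map (0, 0)%N) ?size_zip ?size_tuple ?minnn // nth_zip ?size_tuple //=.
by have := mnmDE (Ordinal ltir) m u; rewrite !(mnm_nth 0%N) => ->.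
Qed.

Lemma contract_row m :
  contract d label_form (fpsX K m) = row_vec (label_row m).
Proof.
apply/ffunP=> u; rewrite !ffunE contract_atX.
  rewrite (nth_map [::]) ?index_mem ?mem_exponents_mnm // nth_index ?mem_exponents_mnm //.
  by rewrite addexp_mnm.
by move=> k ltdk; rewrite /label_form lam0 ?label_vec0 // sumn_mdeg.
Qed.

Definition label_row_bound (s : seq nat) : Prop :=
  (size s = size (exponents r d)) /\ forall k, (nth 0 s k <= t)%N.

Lemma peelable_coef n S (c : seq nat -> K) :
    {in S, forall s, label_row_bound s} -> uniq S -> peelable n S ->
  \sum_(s <- S) c s *: row_vec s = 0 -> {in S, forall s, c s = 0}.
Proof.
elim: n S => [|n IHn] S Sb uS /=; case/orP=> [/eqP-> // | // peelS] sum0.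
have c_iso : {in S, forall s, isolated S s -> c s = 0}.
  move=> s Ss /hasP[k]; rewrite mem_iota /= => ltk.
  case: eqP => // /eqP; rewrite -lt0n => sk_gt0 /allP iso.
  have [szs les] := Sb s Ss.
  have ltk' : (k < size (exponents r d))%N by rewrite -szs.
  have [u uE] := exponents_mnm (mem_nth [::] ltk').
  have lt_t : ((nth 0 s k).-1 < t)%N by rewrite prednK ?les.
  (* In column [u], the coordinate of this label receives a contribution from [s] alone; coordinates
     start at 0, labels at 1. *)
  have := congr1 (fun w : W => w u 0 (Ordinal lt_t)) sum0.
  rewrite sum_ffunE summxE (bigD1_seq s) //= big1_seq ?addr0.
    by rewrite !ffunE !mxE uE index_uniq ?exponents_uniq //= prednK // eqxx mulr1.
  move=> s' /andP[ne_s's Ss']; rewrite !ffunE !mxE uE index_uniq ?exponents_uniq //=.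
  have := iso s' Ss'; rewrite (negbTE ne_s's) prednK //.
  by case: (_ == _) => // _; rewrite mulr0.
move: sum0; rewrite (bigID (isolated S)) /= big1_seq ?add0r; last first.
  by move=> s /andP[iso Ss]; rewrite c_iso ?scale0r.
rewrite -big_filter => sum0 s Ss; have [iso | Niso] := boolP (isolated S s).
  exact: c_iso.
apply: IHn sum0 _ _; rewrite ?filter_uniq ?mem_filter ?Niso //.
by move=> s'; rewrite mem_filter => /andP[_ /Sb].
Qed.

(** A relation on [S'] extends by zero to [S], so one test on [label_rows 0] serves every
    [label_rows i]. *)
Lemma free_peelable n S S' :
    {in S, forall s, label_row_bound s} -> uniq S -> peelable n S ->
    uniq S' -> {subset S' <= S} ->
  free [seq row_vec s | s <- S'].
Proof.
move=> Sb uS peelS uS' sS'S.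
apply/(@freeP _ _ _ (map_tuple row_vec (in_tuple S'))) => k sum0 i.
pose c s := if insub (index s S') is Some j then k j else 0.
have cE (j : 'I_(size S')) : c (nth [::] S' j) = k j.
  by rewrite /c index_uniq // valK.
have cN s : s \notin S' -> c s = 0.
  by move=> NS's; rewrite /c insubF // ltnNge leqNgt index_mem (negbTE NS's).
rewrite -cE; apply: (peelable_coef Sb uS peelS); last by rewrite sS'S // mem_nth.
rewrite (bigID (mem S')) /= [X in _ + X]big1 ?addr0 => [|s /cN->]; last first.
  by rewrite scale0r.
rewrite -big_filter (perm_big S'); last first.
  apply: uniq_perm; rewrite ?filter_uniq // => s.
  by rewrite mem_filter; apply: andb_idr => /sS'S.
rewrite (big_nth [::]) big_mkord -[RHS]sum0.
by apply: eq_bigr => j _; rewrite cE /= (nth_map [::]).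
Qed.

Lemma mem_label_rows i s : reflect
  (exists e, [/\ e \in exponents r d, (i <= sumn e)%N, has (leq 1) s & s = label_row e])
  (s \in label_rows i).
Proof.
rewrite mem_undup mem_filter; apply: (iffP andP).
  case=> has_s /mapP[e]; rewrite mem_filter => /andP[lei ed] sE.
  by exists e.
case=> e [ed lei has_s sE]; split=> //; apply/mapP.
by exists e; rewrite // mem_filter lei.
Qed.

Lemma label_rows_bound i : {in label_rows i, forall s, label_row_bound s}.
Proof.
move=> s /mem_label_rows[e [_ _ _ ->]]; split=> [|k]; first exact: size_map.
have [ltk | lek] := ltnP k (size (exponents r d)).
  by rewrite (nth_map [::]).
by rewrite nth_default // size_map.
Qed.

Lemma label_rows_sub i : {subset label_rows i <= label_rows 0}.
Proof.
by move=> s /mem_label_rows[e [ed _ has_s sE]]; apply/mem_label_rows; exists e.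
Qed.

Lemma row_vec0 s : ~~ has (leq 1) s -> row_vec s = 0.
Proof.
move=> /hasPn s0; apply/ffunP=> u; rewrite !ffunE.
set k := index _ _; suff -> : nth 0%N s k = 0%N by rewrite label_vec0.
have [ltk | lek] := ltnP k (size s); last by rewrite nth_default.
by have := s0 _ (mem_nth 0%N ltk); rewrite -ltnNge ltnS leqn0 => /eqP.
Qed.

Lemma span_label_rows i :
  (\sum_(m : 'X_{1..r < d.+1} | (i <= mdeg m)%N)
     <[contract d label_form (fpsX K m)]> =
   <<[seq row_vec s | s <- label_rows i]>>)%VS.
Proof.
apply/eqP; rewrite eqEsubv; apply/andP; split.
  apply/subv_sumP=> m leim; rewrite -memvE contract_row.
  have [has_m | /row_vec0->] := boolP (has (leq 1) (label_row m)); last exact: mem0v.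
  apply/memv_span/map_f/mem_label_rows; exists (m : seq nat).
  by rewrite mem_exponents_mnm sumn_mdeg.
apply/span_subvP=> _ /mapP[s /mem_label_rows[e [ed lei _ ->]] ->].
have [u uE] := exponents_mnm ed.
rewrite memvE (sumv_sup u) //; first by rewrite -sumn_mdeg uE.
by rewrite contract_row uE.
Qed.

Lemma dim_label_rows i : peelable (size (label_rows 0)) (label_rows 0) ->
  \dim (\sum_(m : 'X_{1..r < d.+1} | (i <= mdeg m)%N)
          <[contract d label_form (fpsX K m)]>) = size (label_rows i).
Proof.
move=> peel; rewrite span_label_rows.
have /eqP-> : free [seq row_vec s | s <- label_rows i].
  apply: (free_peelable (@label_rows_bound 0) _ peel); rewrite ?undup_uniq //.
  exact: label_rows_sub.
by rewrite size_map.
Qed.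

Lemma realizes_hilbert h : realizes h ->
  exists (A : falgType K) (m : {vspace A}),
    [/\ artinian_local A, is_maximal_ideal m, is_level m (last 0%N h),
        cm_type m = last 0%N h & is_hilbert_function m h].
Proof.
case/and5P=> /eqP sz_h /allP hE t_gt0 /allP top_t peel.
have F0 m : (d < mdeg m)%N -> label_form m = 0.
  by move=> ltdm; rewrite /label_form lam0 ?label_vec0 // sumn_mdeg.
have topF : (fullv <= \sum_(m : 'X_{1..r < d.+1} | mdeg m == d) <[label_form m]>)%VS.
  apply/subvP=> v _; rewrite [v]row_sum_delta.
  apply: memv_suml => k _; apply: memvZ.
  have /top_t/hasP[e ed /andP[/eqP sume /eqP lame]] : (k.+1 : nat) \in iota 1 t.
    by rewrite mem_iota /= add1n ltnS ltn_ord.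
  have [u uE] := exponents_mnm ed.
  rewrite memvE (sumv_sup u) // -?memvE; first by rewrite -sumn_mdeg uE sume.
  suff -> : delta_mx 0 k = label_form u by apply: memv_line.
  apply/rowP=> j; rewrite !mxE eqxx /= uE lame eqSS.
  by rewrite (inj_eq val_inj) eq_sym.
have T_gt0 : (0 < dim 'rV[K]_t)%N by rewrite dim_matrix mul1r.
have [A [m [localA maxm sdm socm dimE]]] := inverse_system_level T_gt0 F0 topF.
have last_h : last 0%N h = \dim (idealX m d).
  rewrite dimE dim_label_rows // -nth_last sz_h /=.
  have := hE d; rewrite mem_iota /= add0n ltnSn => /(_ isT)/eqP->.
  (* No exponent vector in the list has degree above [d], so the last difference is the count
     itself. *)
  suff -> : label_rows d.+1 = [::] by rewrite subn0.
  case rows: (label_rows d.+1) => [//|s S].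
  have : s \in label_rows d.+1 by rewrite rows mem_head.
  case/mem_label_rows=> e [+ lt_de _ _].
  by rewrite mem_exponents leqNgt lt_de andbF.
exists A, m; split=> //.
- by exists d; split.
- by rewrite /cm_type socm last_h.
- exists d; split=> // i leid; rewrite !dimE !dim_label_rows //.
  by apply/eqP/hE; rewrite mem_iota.
Qed.

End Labels.

Local Close Scope ring_scope.

(** * Level algebras of embedding dimension three and socle degree four *)

(* Reduction modulo [t.+1] makes one table serve several values of [t = h4]. *)
Definition label (t : nat) (tab : seq (seq (seq nat))) (e : seq nat) : nat :=
  if sumn e <= 4 then
    nth 0 (nth [::] (nth [::] tab (nth 0 e 0)) (nth 0 e 1)) (nth 0 e 2) %% t.+1
  else 0.

(* Entry [c] of entry [b] of entry [a] labels the monomial [x^a y^b z^c].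
   The tables were found by computer search. *)
Definition label_table (h2 h3 h4 : nat) : seq (seq (seq nat)) :=
  match h2, h3, h4 with
  | 1, 1, _ => [:: [:: [::]; [::]; [::]; [::]; [:: 1]]; [:: [:: 0; 1]]]
  | 2, 1, _ => [:: [:: [::]; [::]; [:: 1]]; [:: [:: 0; 0; 1]]; [::]; [::];
      [:: [:: 1]]]
  | 2, 2, _ => [:: [:: [:: 0; 0; 1]]; [::]; [::]; [:: [::]; [:: 1]];
      [:: [:: 2]]]
  | 3, 1, _ => [:: [:: [::]; [::]; [:: 0; 1]]; [::]; [::]; [::]; [:: [:: 1]]]
  | 3, 2, _ => [:: [:: [:: 0; 0; 0; 0; 2]; [::]; [::]; [:: 1]];
      [:: [:: 0; 0; 0; 1]]]
  | 3, 3, _ => [:: [:: [:: 0; 0; 0; 0; 1]; [:: 0; 0; 0; 4]]; [::]; [::];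
      [:: [::]; [:: 3]]; [:: [:: 2]]]
  | 3, 4, _ => [:: [:: [:: 0; 0; 0; 0; 2]; [::]; [:: 1]];
      [:: [:: 0; 0; 0; 5]]; [:: [:: 0; 0; 3]]; [:: [:: 0; 4]]; [:: [:: 1]]]
  | 4, 2, _ => [:: [:: [:: 0; 0; 0; 0; 1]; [::]; [:: 0; 0; 3]; [::]; [:: 2]];
      [::]; [:: [::]; [:: 1]]]
  | 4, 3, 1 => [:: [::]; [:: [::]; [:: 0; 0; 1]]]
  | 4, 3, _ => [:: [:: [::]; [::]; [::]; [:: 0; 1]; [:: 3]]; [:: [::]; [::];
      [::]; [:: 2]]; [::]; [:: [:: 1]]]
  | 4, 4, _ => [:: [:: [:: 0; 0; 0; 1]; [::]; [::]; [::]; [:: 1]]; [:: [::];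
      [::]; [::]; [:: 3]]; [:: [::]; [::]; [:: 2]]; [:: [::]; [:: 5]];
      [:: [:: 4]]]
  | 4, 5, _ => [:: [:: [:: 0; 0; 0; 0; 2]; [::]; [::]; [::]; [:: 1]];
      [:: [::]; [::]; [::]; [:: 6]]; [:: [::]; [::]; [:: 4]]; [:: [::];
      [:: 5]]; [:: [:: 3]]]
  | 5, 2, _ => [:: [:: [:: 0; 0; 0; 0; 1]; [::]; [::]; [:: 1]];
      [:: [:: 0; 0; 0; 2]; [:: 0; 1]]]
  | 5, 3, 1 => [:: [::]; [:: [::]; [::]; [:: 0; 1]]; [::]; [::]; [:: [:: 1]]]
  | 5, 3, _ => [:: [:: [::]; [::]; [::]; [::]; [:: 1]]; [:: [:: 0; 0; 1];
      [::]; [::]; [:: 3]]; [:: [::]; [::]; [:: 2]]]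
  | 5, 4, _ => [:: [:: [:: 0; 0; 0; 2]; [:: 0; 0; 1]; [::]; [::]; [:: 1]];
      [:: [::]; [::]; [::]; [:: 4]]; [:: [::]; [::]; [:: 2]]; [:: [::];
      [:: 3]]; [:: [:: 5]]]
  | 5, 5, _ => [:: [:: [:: 0; 0; 0; 0; 5]; [::]; [::]; [:: 2]; [:: 6]];
      [:: [:: 0; 0; 0; 10]; [::]; [:: 1]]; [:: [:: 0; 0; 8]]; [:: [:: 0; 11];
      [:: 7]]; [:: [:: 9]]]
  | 5, 6, _ => [:: [:: [:: 0; 0; 0; 0; 4]; [:: 0; 0; 0; 2]];
      [:: [:: 0; 0; 0; 6]; [:: 0; 0; 1]]; [:: [:: 0; 0; 3]]; [:: [:: 0; 7]];
      [:: [:: 5]]]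
  | 5, 7, _ => [:: [:: [:: 0; 0; 0; 0; 4]; [::]; [::]; [::]; [:: 8]];
      [:: [:: 0; 0; 0; 2]; [::]; [::]; [:: 1]]; [:: [:: 0; 0; 7]; [::];
      [:: 3]]; [:: [:: 0; 9]; [:: 5]]; [:: [:: 6]]]
  | 6, 2, _ => [:: [:: [:: 0; 0; 0; 0; 2]; [:: 0; 0; 0; 1]; [::]; [:: 1]];
      [::]; [:: [:: 0; 1]; [:: 2]]]
  | 6, 3, 1 => [:: [:: [::]; [::]; [:: 0; 0; 1]]; [::]; [:: [::]; [:: 0; 1]]]
  | 6, 3, _ => [:: [:: [:: 0; 0; 0; 0; 2]; [:: 0; 0; 0; 1]];
      [:: [:: 0; 0; 0; 3]; [::]; [:: 2]]; [:: [:: 0; 0; 1]; [:: 1]]]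
  | 6, 4, 2 => [:: [::]; [:: [::]; [:: 0; 0; 1]]; [:: [::]; [::]; [:: 1]];
      [::]; [:: [:: 2]]]
  | 6, 4, _ => [:: [:: [:: 0; 0; 0; 0; 4]; [::]; [::]; [:: 1]];
      [:: [:: 0; 0; 0; 3]; [:: 0; 1]]; [:: [:: 0; 0; 1]]; [:: [:: 0; 2]];
      [:: [:: 5]]]
  | 6, 5, _ => [:: [:: [:: 0; 0; 0; 2]; [::]; [::]; [:: 0; 10]; [:: 5]];
      [:: [::]; [:: 0; 1]; [::]; [:: 8]]; [:: [::]; [::]; [:: 4]];
      [:: [:: 0; 7]; [:: 6]]; [:: [:: 9]]]
  | 6, 6, _ => [:: [:: [:: 0; 0; 0; 0; 9]; [:: 0; 0; 0; 7]; [::]; [::];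
      [:: 6]]; [:: [:: 0; 0; 0; 8]; [:: 0; 1]; [::]; [:: 11]]; [:: [::]; [::];
      [:: 12]]; [:: [::]; [:: 5]]; [:: [:: 10]]]
  | 6, 7, _ => [:: [:: [:: 0; 0; 0; 0; 7]; [:: 0; 0; 0; 8]; [::]; [:: 1]];
      [:: [:: 0; 0; 0; 6]; [:: 0; 0; 2]]; [:: [:: 0; 0; 1]; [:: 0; 3]];
      [:: [:: 0; 5]; [:: 9]]; [:: [:: 4]]]
  | 6, 8, _ => [:: [:: [:: 0; 0; 0; 0; 9]; [:: 0; 0; 0; 8]; [:: 0; 0; 10];
      [:: 0; 4]; [:: 7]]; [:: [::]; [::]; [::]; [:: 5]]; [:: [::]; [::];
      [:: 2]]; [:: [:: 0; 1]; [:: 6]]; [:: [:: 3]]]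
  | 6, 9, _ => [:: [:: [:: 0; 0; 0; 0; 11]; [:: 0; 0; 0; 8]; [:: 0; 0; 7];
      [:: 0; 9]; [:: 12]]; [:: [:: 0; 0; 0; 2]; [:: 0; 0; 6]; [:: 0; 3];
      [:: 5]]; [:: [:: 0; 0; 10]; [:: 0; 4]; [:: 1]]]
  | 6, 10, _ => [:: [:: [:: 0; 0; 0; 0; 9]; [:: 0; 0; 0; 5]; [:: 0; 0; 3];
      [:: 0; 10]; [:: 7]]; [:: [:: 0; 0; 0; 13]; [:: 0; 0; 15]; [:: 0; 14];
      [:: 12]]; [:: [:: 0; 0; 8]; [:: 0; 6]; [:: 11]]; [:: [:: 0; 2]; [:: 4]];
      [:: [:: 1]]]
  | _, _, _ => [::]
  end.

(** The values [a^<2>] for [1 <= a <= 6], where [6 = 3^<1>] bounds [h2]. *)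
Definition macaulay2 (a : nat) : nat := nth 0 [:: 0; 1; 2; 4; 5; 7; 10] a.

Definition macaulay3 (a : nat) : nat :=
  nth 0 [:: 0; 1; 2; 3; 5; 6; 7; 9; 10; 12; 15] a.

(** Growth bounds and numerical condition in decidable form; positivity is left to the ranges of the
    enumeration. *)
Definition admissible (h2 h3 h4 : nat) : bool :=
  [&& h3 <= macaulay2 h2, h4 <= macaulay3 h3
    & if h4 == 1 then (h3 <= 3) && (h2 <= 'C(h3.+1, 2) + (3 - h3))
      else h3 <= 3 * h4].

(** The bounds 6, 10 and 15 count the monomials of degrees 2, 3 and 4 in three variables. The [if]
    keeps call by value from testing inadmissible triples. *)
Lemma label_table_realizes :
  all (fun h2 => all (fun h3 => all (fun h4 => if admissible h2 h3 h4
    then realizes 3 4 h4 (label h4 (label_table h2 h3 h4)) [:: 1; 3; h2; h3; h4]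
    else true)
    (iota 1 15)) (iota 1 10)) (iota 1 6).
Proof. by vm_cast_no_check (erefl true). Qed.

Lemma label_le t tab e : label t tab e <= t.
Proof. by rewrite /label; case: ifP => // _; rewrite -ltnS ltn_pmod. Qed.

Lemma label_deg t tab e : 4 < sumn e -> label t tab e = 0.
Proof. by rewrite /label ltnNge => /negbTE->. Qed.

Lemma macaulay_power1 a b : macaulay_power 1 a b -> b = 'C(a.+1, 2).
Proof.
case=> -[|x [|y c]] [/andP[sz_gt0 sz_le] _ _] //= -> ->.
by rewrite !big_ord_recl !big_ord0 /= !addn0 bin1.
Qed.

Lemma ltn_bin_inv k x a n : 'C(x, k) <= a -> a < 'C(n, k) -> x < n.
Proof.
by move=> le_a lt_a; rewrite ltnNge; apply: contraTN lt_a => /(leq_bin2l k);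
   rewrite -leqNgt => /leq_trans; apply.
Qed.

(** As ['C(5, 2) = 10] exceeds 6, the leading term of an expansion is below 5, and finitely many
    expansions remain to be inspected. *)
Lemma macaulay_power2 a b : a <= 6 -> macaulay_power 2 a b -> b = macaulay2 a.
Proof.
move=> le6 [[|x [|y [|z c]]] [/andP[]] //= _ _ + + aE ->];
  rewrite /= ?andbT => srt lst;
  rewrite !big_ord_recl !big_ord0 /= ?addn0 in aE *.
  have : x < 5 by apply: (@ltn_bin_inv 2 x 6); rewrite -?aE.
  by move: lst {le6}; rewrite aE; move: x {aE srt}; do 5?case=> //.
have ltx : x < 5.
  by apply: (@ltn_bin_inv 2 x 6); rewrite // (leq_trans _ le6) // aE leq_addr.
rewrite aE in le6 *; move: ltx srt lst le6 {aE}.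
by case: x => [|[|[|[|[|x]]]]] //; case: y => [|[|[|[|y]]]].
Qed.

Lemma macaulay_power3 a b : a <= 10 -> macaulay_power 3 a b -> b = macaulay3 a.
Proof.
move=> le10 [[|x [|y [|z [|w c]]]] [/andP[]] //= _ _ + + aE ->];
  rewrite /= ?andbT => srt lst;
  rewrite !big_ord_recl !big_ord0 /= ?addn0 in aE *;
  (* The bound 6 comes from ['C(6, 3) = 20 > 10]. *)
  (have ltx : x < 6 by
     apply: (@ltn_bin_inv 3 x 10); rewrite // (leq_trans _ le10) // aE ?leq_addr);
  rewrite aE in le10 *; move: ltx srt lst le10 {aE}.
- by case: x => [|[|[|[|[|[|x]]]]]].
- by case: x => [|[|[|[|[|[|x]]]]]] //; case: y => [|[|[|[|[|y]]]]].
by case: x => [|[|[|[|[|[|x]]]]]] //; case: y => [|[|[|[|[|y]]]]] //;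
   case: z => [|[|[|[|z]]]].
Qed.

Lemma O_sequence_admissible h2 h3 h4 : O_sequence [:: 1; 3; h2; h3; h4] ->
  [/\ 0 < h2 <= 6, 0 < h3 <= macaulay2 h2 & 0 < h4 <= macaulay3 h3].
Proof.
case=> /and5P[_ _ h2_gt0 h3_gt0 /andP[h4_gt0 _]] _ Om.
have [b2 /macaulay_power1-> /= le6] := Om 1 isT isT.
have [b3 /(macaulay_power2 le6)-> /= le3] := Om 2 isT isT.
have le10 : h3 <= 10.
  by apply: leq_trans le3 _; move: h2 le6 {Om h2_gt0}; do 7?case=> //.
have [b4 /(macaulay_power3 le10)-> /= le4] := Om 3 isT isT.
by rewrite h2_gt0 h3_gt0 h4_gt0.
Qed.

Lemma label_table_hilbert (K : fieldType) h2 h3 h4 :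
    O_sequence [:: 1; 3; h2; h3; h4] -> admissible h2 h3 h4 ->
  exists (A : falgType K) (m : {vspace A}),
    [/\ artinian_local A, is_maximal_ideal m, is_level m h4,
        cm_type m = h4 & is_hilbert_function m [:: 1; 3; h2; h3; h4]].
Proof.
case/O_sequence_admissible => /andP[gt2 le2] /andP[gt3 le3] /andP[gt4 le4] adm.
have le3' : h3 <= 10.
  by apply: leq_trans le3 _; move: h2 le2 {adm gt2}; do 7?case=> //.
have le4' : h4 <= 15.
  by apply: leq_trans le4 _; move: h3 le3' {adm gt3 le3}; do 11?case=> //.
set tab := label_table h2 h3 h4.
apply: (realizes_hilbert (r := 3) (@label_le h4 tab) (@label_deg h4 tab) K
  (h := [:: 1; 3; h2; h3; h4])).
have /allP/(_ h2) := label_table_realizes; rewrite mem_iota gt2 ltnS le2 => /(_ isT).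
move=> /allP/(_ h3); rewrite mem_iota gt3 ltnS le3' => /(_ isT).
move=> /allP/(_ h4); rewrite mem_iota gt4 ltnS le4' => /(_ isT).
by rewrite adm.
Qed.

Theorem theorem1 (K : closedFieldType) (charK0 : [pchar K]%R =i pred0)
    (h2 h3 h4 : nat) (Oh : O_sequence [:: 1; 3; h2; h3; h4]) :
  (h4 = 1 ->
     (Gorenstein_Oseq K [:: 1; 3; h2; h3; h4] <->
      h3 <= 3 /\ h2 <= 'C(h3.+1, 2) + (3 - h3)))
  /\
  (2 <= h4 ->
     (level_Oseq K [:: 1; 3; h2; h3; h4] <-> h3 <= 3 * h4)).
Proof.
have [_ /andP[_ le3] /andP[_ le4]] := O_sequence_admissible Oh.
split=> [h41 | h4_gt1]; split.
- by rewrite h41; apply: Gorenstein_hilbert_le.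
- case=> le_h3 le_h2; have adm : admissible h2 h3 h4.
    by rewrite /admissible le3 le4 h41 /= le_h3.
  have [A [m [localA maxm _ typem Hm]]] := label_table_hilbert K Oh adm.
  by exists A, m; split=> //; rewrite /is_Gorenstein typem.
- exact: level_hilbert3_le.
- move=> le_h3; have adm : admissible h2 h3 h4.
    by rewrite /admissible le3 le4 gtn_eqF.
  have [A [m [localA maxm levm _ Hm]]] := label_table_hilbert K Oh adm.
  by exists A, m, h4.
Qed.
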